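(* Let $m=m_0>m_1>\cdots>m_r=0$ be the pole numbers at $P$ that are smaller than or equal to $m$. For every $i\ge1$, if $G_i(P)\supsetneq G_{i+1}(P)$, then $i+1=m-m_k+1$ for some pole number $m_k$, $0\le k\le r$.
   Context: $C$ is a nonsingular complete curve of genus $g$ over an algebraically closed field $k$ of characteristic $p>0$, $G$ is a finite subgroup of $\mathrm{Aut}(C)$, and $P$ is a wildly ramified point of $C$ for $G$. $G_0(P)$ is the stabilizer of $P$ in $G$; with $t$ a local uniformizer at $P$, $G_i(P)=\{\sigma\in G_0(P): v_P(\sigma(t)-t)\ge i+1\}$. $L(iP)=\{f\in k(C):\mathrm{div}(f)+iP\ge0\}$. A pole number at $P$ is an integer $i\ge 0$ such that $i=0$ or $L((i-1)P)\subsetneq L(iP)$. $m\le 2g-1$ is the smallest pole number at $P$ not divisible by $p$. (The group $G_1(P)$ acts faithfully on $L(mP)$ by its natural action on functions.) *)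

(* Defs.v *)
From HB Require Import structures.
From mathcomp Require Import all_boot all_order all_algebra.
From mathcomp Require Import freeg.
From mathcomp Require Import boolp classical_sets functions cardinality.
From mathcomp Require Import constructive_ereal.

Set Implicit Arguments.
Unset Strict Implicit.
Unset Printing Implicit Defensive.

Import Order.TTheory GRing.Theory Num.Theory.

Local Open Scope classical_set_scope.
Local Open Scope ring_scope.

(* A nonsingular complete curve C over an algebraically closed field k is
   given by its function field K = k(C), with iota : k -> K the inclusion of
   the constants.  Its (closed) points are the discrete valuations of K
   trivial on k, and its automorphisms are the k-automorphisms of K. *)

Section Curve.
Context (k K : fieldType) (iota : {rmorphism k -> K}).

Definition in_simple_ext (x y : K) : Prop :=
  exists P Q : {poly k},
    (map_poly iota Q).[x] != 0 /\
    y = (map_poly iota P).[x] / (map_poly iota Q).[x].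

Definition is_function_field : Prop :=
  exists2 x : K, ~ algebraicOver iota x &
  exists (n : nat) (b : 'I_n -> K), forall y : K,
    exists2 a : 'I_n -> K,
      forall j, in_simple_ext x (a j) & y = \sum_(j < n) a j * b j.

(* v_P takes the value +oo at 0, and only there. *)
Record curve_point := CurvePoint {
  val_at :> K -> \bar int;
  val_eq_pinfty : forall f, val_at f = +oo%E <-> f = 0;
  val_neq_ninfty : forall f, val_at f <> -oo%E;
  val_mul : forall f h, val_at (f * h) = (val_at f + val_at h)%E;
  val_add : forall f h,
    (Order.min (val_at f) (val_at h) <= val_at (f + h)%R)%E;
  val_const : forall c : k, c != 0 -> val_at (iota c) = 0%E;
  val_surj : exists t, val_at t = 1%:E }.

Lemma curve_point_ext (P Q : curve_point) : (forall f, P f = Q f) -> P = Q.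
Proof.
case: P => v a b c d e h; case: Q => v' a' b' c' d' e' h' /= E.
have Ev : v = v' by apply/funext.
by subst v'; congr CurvePoint; apply: Prop_irrelevance.
Qed.

HB.instance Definition _ := gen_eqMixin curve_point.
HB.instance Definition _ := gen_choiceMixin curve_point.

Definition uniformizer (P : curve_point) (t : K) : Prop := P t = 1%:E.

Definition divisor := {freeg curve_point}.

Definition Lspace (D : divisor) : set K :=
  [set f | forall Q : curve_point, ((- coeff Q D)%:E <= Q f)%E].

Definition has_dim (V : set K) (n : nat) : Prop :=
  exists b : 'I_n -> K,
    (forall c : 'rV[k]_n, \sum_(j < n) iota (c 0 j) * b j = 0 -> c = 0) /\
    (forall f, V f <->
       exists c : 'rV[k]_n, f = \sum_(j < n) iota (c 0 j) * b j).

(* g is the maximum of deg D - l(D) + 1 over all divisors D (Riemann). *)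
Definition is_genus (g : nat) : Prop :=
  (forall (D : divisor) (n : nat),
      has_dim (Lspace D) n -> deg D - n%:Z + 1 <= g%:Z) /\
  (exists (D : divisor) (n : nat),
      has_dim (Lspace D) n /\ deg D - n%:Z + 1 = g%:Z).

Definition pole_number (P : curve_point) (i : nat) : Prop :=
  i = 0%N \/ Lspace << (i%:Z - 1) *g P >> `<` Lspace << i%:Z *g P >>.

Record aut := Aut {
  aut_fun :> {rmorphism K -> K};
  aut_invfun : {rmorphism K -> K};
  aut_funK : cancel aut_fun aut_invfun;
  aut_invfunK : cancel aut_invfun aut_fun;
  aut_fun_const : forall c : k, aut_fun (iota c) = iota c }.

Lemma aut_ext (s u : aut) : (forall f, s f = u f) -> s = u.
Proof.
have rext (a b : {rmorphism K -> K}) : (forall x, a x = b x) -> a = b.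
  case: a => fa ca; case: b => fb cb /= E.
  have Ef : fa = fb by apply/funext.
  subst fb; congr GRing.RMorphism.Pack.
  case: ca => -[m1] [m2]; case: cb => -[m1'] [m2'].
  by do 2!f_equal; apply: Prop_irrelevance.
case: s => a a' Ka Ka' ca; case: u => b b' Kb Kb' cb /= E.
have Eab : a = b by apply: rext.
subst b; have E' : a' = b' by apply: rext => x; rewrite -{1}(Kb' x) Ka.
by subst b'; congr Aut; apply: Prop_irrelevance.
Qed.

Lemma aut_invfun_const (s : aut) (c : k) : aut_invfun s (iota c) = iota c.
Proof. by rewrite -{1}(aut_fun_const s c) aut_funK. Qed.

Definition aut_one : aut :=
  @Aut idfun idfun (fun=> erefl) (fun=> erefl) (fun=> erefl).

Lemma aut_mul_const (s u : aut) (c : k) : (s \o u) (iota c) = iota c.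
Proof. by rewrite /= !aut_fun_const. Qed.

Definition aut_mul (s u : aut) : aut :=
  @Aut (s \o u) (aut_invfun u \o aut_invfun s)
    (can_comp (aut_funK s) (aut_funK u))
    (can_comp (aut_invfunK u) (aut_invfunK s))
    (aut_mul_const s u).

Definition aut_inv (s : aut) : aut :=
  @Aut (aut_invfun s) s (aut_invfunK s) (aut_funK s) (aut_invfun_const s).

Definition is_subgroup (G : set aut) : Prop :=
  [/\ G aut_one,
      (forall s u, G s -> G u -> G (aut_mul s u)) &
      (forall s, G s -> G (aut_inv s))].

(* s acts on functions by s f = f o s^-1, so that the value of f at s P is
   that of s^-1 f at P. *)
Section PointAction.
Context (s : aut) (P : curve_point).
Let v (f : K) : \bar int := P (aut_inv s f).

Fact act_point_eq_pinfty f : v f = +oo%E <-> f = 0.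
Proof.
rewrite /v val_eq_pinfty; split=> [|->]; last exact: rmorph0.
by move/(congr1 s); rewrite /= aut_invfunK rmorph0.
Qed.

Fact act_point_neq_ninfty f : v f <> -oo%E.
Proof. exact: val_neq_ninfty. Qed.

Fact act_point_mul f h : v (f * h) = (v f + v h)%E.
Proof. by rewrite /v rmorphM val_mul. Qed.

Fact act_point_add f h : (Order.min (v f) (v h) <= v (f + h)%R)%E.
Proof. by rewrite /v rmorphD val_add. Qed.

Fact act_point_const c : c != 0 -> v (iota c) = 0%E.
Proof. by move=> c0; rewrite /v aut_fun_const val_const. Qed.

Fact act_point_surj : exists t, v t = 1%:E.
Proof.
have [t Pt] := val_surj P; exists (s t).
by rewrite /v /= aut_funK.
Qed.

Definition act_point : curve_point :=
  CurvePoint act_point_eq_pinfty act_point_neq_ninfty act_point_mul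
    act_point_add act_point_const act_point_surj.

End PointAction.

Definition stabilizer (G : set aut) (P : curve_point) : set aut :=
  [set s | G s /\ act_point s P = P].

Definition ramification_group (G : set aut) (P : curve_point) (t : K)
    (i : nat) : set aut :=
  [set s | stabilizer G P s /\ ((i.+1%:Z)%:E <= P (s t - t)%R)%E].

Definition invariant_under (G : set aut) (f : K) : Prop := forall s, G s -> s f = f.

(* Ramification index at P of the cover C -> C/G, where k(C/G) = K^G:
   the restriction of v_P to K^G has value group e Z. *)
Definition is_ramification_index (G : set aut) (P : curve_point) (e : nat) :
    Prop :=
  [/\ (0 < e)%N,
      (exists2 f, invariant_under G f & P f = (e%:Z)%:E) &
      (forall f, invariant_under G f -> f != 0 ->
         exists n : int, P f = (e%:Z * n)%:E)].

Definition wildly_ramified (p : nat) (G : set aut) (P : curve_point) : Prop :=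
  exists2 e, is_ramification_index G P e & (p %| e)%N.

End Curve.

(* Main.v *)
Require Import Defs.
From HB Require Import structures.
From mathcomp Require Import all_boot all_order all_algebra.
From mathcomp Require Import freeg.
From mathcomp Require Import boolp classical_sets functions cardinality.
From mathcomp Require Import constructive_ereal.
From mathcomp Require Import ring zify.

Set Implicit Arguments.
Unset Strict Implicit.
Unset Printing Implicit Defensive.

Import Order.TTheory GRing.Theory Num.Theory.

Local Open Scope classical_set_scope.
Local Open Scope ring_scope.

(** Let [s] lie in G_i(P) but not in G_{i+1}(P), so that [s t - t] has valuation
exactly i + 1 for v = v_P, and let [f] be a function whose only pole is P, of order
exactly m.  Since p does not divide m, writing [f] as a unit times [t ^- m]
and expanding [s t = t * (1 + e)] with [v e = i] shows that [s f - f] has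
valuation exactly i - m ([val_displacement_pole]); the unit only contributes
terms of higher order ([displacement_integral]).  As [s] fixes P, [s f - f] is
again regular away from P.  If i <= m, it witnesses that m - i is a pole
number, which is the claim.  If i > m, it is a nonzero function without poles
that vanishes at P, and there are none ([regular_vanishing_eq0]).

Two standard facts must be derived from the valuation-theoretic description
of the curve.

The residue field of a point is k ([residue_constant]); this is what makes the unit
part of [f] move little.  An [u] integral for v that is not congruent to any
constant would satisfy v (q(u)) = 0 for every nonzero polynomial q, hence
would be transcendental over k and v would be trivial on k(u).  But K has
transcendence degree 1, so K is algebraic over k(u)
([integral_simple_ext_transcendental]), whereas an element of positive finite
valuation is never algebraic over a trivially valued subfield
([not_root_trivially_valued]).

A function without poles that vanishes somewhere is zero
([regular_vanishing_eq0]).  This comes from finiteness of the genus: if D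
attains the genus, then L(D) is finite-dimensional and strictly contained in
L(D + P), and multiplying some w in L(D + P) by the powers of a nonzero
counterexample h would produce infinitely many independent elements w h^j of
L(D). *)

(** * Simple extensions inside a function field *)

Section SimpleExtension.
Variables (k K : fieldType) (iota : {rmorphism k -> K}).

(** Evaluation at [z] is the composite of two ring morphisms, so that it inherits
their structure; up to conversion it is the evaluation in [in_simple_ext]. *)
Definition eval_at (z : K) : {poly k} -> K := horner_eval z \o map_poly iota.
HB.instance Definition _ z := GRing.RMorphism.on (eval_at z).

Lemma in_simple_extP z y : in_simple_ext iota z y <->
  exists N D, eval_at z D != 0 /\ y = eval_at z N / eval_at z D.
Proof. by []. Qed.

Definition simple_ext z : {pred K} := [pred y | `[< in_simple_ext iota z y >]].

Lemma simple_ext_eval z q : eval_at z q \in simple_ext z.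
Proof.
apply/asboolP/in_simple_extP; exists q, 1.
by rewrite rmorph1 oner_neq0 divr1.
Qed.

Fact simple_ext_divring z : divring_closed (simple_ext z).
Proof.
split=> [|_ _ /asboolP/in_simple_extP[N [D [D0 ->]]]
  /asboolP/in_simple_extP[N' [D' [D0' ->]]]
  |_ _ /asboolP/in_simple_extP[N [D [D0 ->]]]
  /asboolP/in_simple_extP[N' [D' [D0' ->]]]].
- by rewrite -(rmorph1 (eval_at z)) simple_ext_eval.
- apply/asboolP/in_simple_extP; exists (N * D' - N' * D), (D * D').
  by rewrite rmorphB !rmorphM mulf_neq0 //; split=> //; field; rewrite D0 D0'.
- have [N0|N0] := eqVneq (eval_at z N') 0.
    by rewrite N0 mul0r invr0 mulr0 -(rmorph0 (eval_at z)) simple_ext_eval.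
  apply/asboolP/in_simple_extP; exists (N * D'), (D * N').
  by rewrite !rmorphM mulf_neq0 //; split=> //; field; rewrite N0 D0 D0'.
Qed.

HB.instance Definition _ z :=
  GRing.isDivringClosed.Build K (simple_ext z) (simple_ext_divring z).

(** The field k(z) as a type: the theory of integral elements needs the base to
be a field with a morphism to K, not merely a predicate on K. *)
Record simple_ext_field z :=
  SimpleExtField { sext_val :> K; sext_valP : sext_val \in simple_ext z }.

HB.instance Definition _ z := [isSub for @sext_val z].
HB.instance Definition _ z := [Choice of simple_ext_field z by <:].
HB.instance Definition _ z :=
  [SubChoice_isSubIntegralDomain of simple_ext_field z by <:].
HB.instance Definition _ z :=
  [SubIntegralDomain_isSubField of simple_ext_field z by <:].

Fact sext_val_is_zmod_morphism z : zmod_morphism (@sext_val z).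
Proof. by []. Qed.
HB.instance Definition _ z :=
  GRing.isZmodMorphism.Build _ _ (@sext_val z) (@sext_val_is_zmod_morphism z).

Fact sext_val_is_monoid_morphism z : monoid_morphism (@sext_val z).
Proof. by []. Qed.
HB.instance Definition _ z :=
  GRing.isMonoidMorphism.Build _ _ (@sext_val z)
    (@sext_val_is_monoid_morphism z).


Lemma integral_simple_ext z y : y \in simple_ext z -> integralOver (@sext_val z) y.
Proof. by move=> yz; exact: (integral_id (@sext_val z) (SimpleExtField yz)). Qed.

Lemma simple_ext_clear_denominators z (F : {poly simple_ext_field z}) :
  exists2 d : {poly k}, eval_at z d != 0 &
  exists F' : {poly {poly k}},
    map_poly (eval_at z) F' = eval_at z d *: map_poly (@sext_val z) F.
Proof.
elim/poly_ind: F => [|F c [d d0 [F' F'E]]].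
  by exists 1; rewrite ?rmorph1 ?oner_neq0 //; exists 0; rewrite !rmorph0 scaler0.
have /asboolP/in_simple_extP[N [D [D0 cE]]] := sext_valP c.
exists (d * D); first by rewrite rmorphM mulf_neq0.
exists (D%:P * F' * 'X + (d * N)%:P).
have map_cE : map_poly (@sext_val z) (F * 'X + c%:P)
    = map_poly (@sext_val z) F * 'X + (sext_val c)%:P.
  by rewrite rmorphD rmorphM /= map_polyX map_polyC.
have map_F'E : map_poly (eval_at z) (D%:P * F' * 'X + (d * N)%:P)
    = (eval_at z D)%:P * map_poly (eval_at z) F' * 'X
      + (eval_at z d * eval_at z N)%:P.
  by rewrite !(rmorphD, rmorphM) /= map_polyX !map_polyC.
rewrite map_cE cE map_F'E F'E -!mul_polyC (rmorphM (eval_at z) d D) mulrDr.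
congr (_ + _); first by rewrite polyCM; ring.
by rewrite -polyCM; congr _%:P; field; exact: D0.
Qed.


Section FunctionField.
Variables (x : K) (n : nat) (b : 'I_n -> K).
Hypothesis gen_b : forall y : K, exists2 a : 'I_n -> K,
  forall j, in_simple_ext iota x (a j) & y = \sum_(j < n) a j * b j.

(** Multiplication by [y] is given on the generators [b] by a matrix over k(x), of
which [y] is an eigenvalue; so the characteristic polynomial of that matrix is
an integral equation for [y]. *)
Lemma integral_simple_ext_generator y : integralOver (@sext_val x) y.
Proof.
have : forall i, exists a : 'I_n -> simple_ext_field x,
    y * b i = \sum_(j < n) sext_val (a j) * b j.
  move=> i; have [a aE ->] := gen_b (y * b i).
  by exists (fun j => SimpleExtField (introT (asboolP _) (aE j))).
move=> /choice[A AE].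
pose M := \matrix_(j, i) A i j.
exists (char_poly M); first exact: char_poly_monic.
rewrite map_char_poly -eigenvalue_root_char; apply/eigenvalueP.
exists (\row_j b j).
  apply/rowP => i; rewrite !mxE AE.
  by apply: eq_bigr => j _; rewrite !mxE mulrC.
apply/eqP => /rowP b0; have [a _ /eqP] := gen_b 1.
rewrite big1 ?oner_eq0// => j _.
by have := b0 j; rewrite !mxE => ->; rewrite mulr0.
Qed.

Variable u : K.
Hypothesis transc_u : forall q, q != 0 -> eval_at u q != 0.

(** The exchange property: clearing denominators in an equation of [u] over k(x)
gives a polynomial relation F(x, u) = 0, which, read as an equation for [x],
is nontrivial because no nonzero coefficient polynomial vanishes at [u]. *)
Lemma integral_generator_exchange : integralOver (@sext_val u) x.
Proof.
have /integral_algebraic[F F0 Fu] := integral_simple_ext_generator u.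
have [d d0 [F' F'E]] := simple_ext_clear_denominators F.
have F'0 : F' != 0.
  apply: contraNneq F0 => F'0; move/eqP: F'E.
  by rewrite F'0 rmorph0 eq_sym scaler_eq0 (negbTE d0) /= map_poly_eq0.
pose F1 := map_poly (map_poly iota) F'.
have F1x : map_poly (horner_eval x) F1 = map_poly (eval_at x) F'.
  by rewrite -map_poly_comp.
have F1u : map_poly (horner_eval u) (swapXY F1)
         = map_poly (eval_at u) (swapXY F').
  by rewrite /F1 swapXY_map -map_poly_comp.
apply: (@integral_root _ _ _ (map_poly (eval_at u) (swapXY F'))).
- apply/eqP => /polyP/(_ (size (swapXY F')).-1).
  rewrite coef_map coef0 => /eqP; apply/negP/transc_u.
  by rewrite -[_`_ _]/(lead_coef _) lead_coef_eq0 swapXY_eq0.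
- rewrite -F1u -horner_swapXY swapXYK /root.
  have := Fu; rewrite /root => /eqP Fu0.
  have : (map_poly (horner_eval x) F1).[horner_eval x u%:P] == 0.
    by rewrite F1x F'E /horner_eval hornerC hornerZ Fu0 mulr0.
  by rewrite horner_map.
- apply/integral_poly => i; rewrite coef_map /=.
  exact/integral_simple_ext/simple_ext_eval.
Qed.

(** K has transcendence degree 1: it is algebraic over k(u) for any transcendental
[u], by transitivity through k(x). *)
Lemma integral_simple_ext_transcendental y : integralOver (@sext_val u) y.
Proof.
have intE q : integralOver (@sext_val u) (eval_at x q).
  apply: integral_horner integral_generator_exchange.
  apply/integral_poly => i; rewrite coef_map /=.
  apply: integral_simple_ext.
  suff -> : iota q`_i = eval_at u (q`_i)%:P by exact: simple_ext_eval.
  by rewrite /eval_at /= map_polyC /horner_eval hornerC.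
have [q q_mon qy] := integral_simple_ext_generator y.
apply: integral_root_monic qy _; first exact: monic_map.
apply/integral_poly => i; rewrite coef_map /=.
have /asboolP/in_simple_extP[N [D [_ ->]]] := sext_valP q`_i.
exact: integral_div.
Qed.

End FunctionField.
End SimpleExtension.

(** * Discrete valuations *)

Section Valuation.
Variables (k K : fieldType) (iota : {rmorphism k -> K}) (v : curve_point iota).
Implicit Types (f h : K) (a b : int).

Lemma val_fin f : f != 0 -> exists a, v f = a%:E.
Proof.
move=> f0; case vf: (v f) => [a| |]; first by exists a.
  by have /eqP := f0; rewrite -(val_eq_pinfty v) vf.
by case: (val_neq_ninfty vf).
Qed.

Lemma val0 : v 0 = +oo%E. Proof. exact/val_eq_pinfty. Qed.

Lemma val1 : v 1 = 0%E.
Proof. by rewrite -(rmorph1 iota) val_const ?oner_neq0. Qed.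

Lemma valN f : v (- f) = v f.
Proof.
rewrite -mulN1r val_mul -[-1](rmorphN1 iota) val_const ?add0e //.
by rewrite oppr_eq0 oner_neq0.
Qed.

Lemma val_eqM f h a b : v f = a%:E -> v h = b%:E -> v (f * h) = (a + b)%:E.
Proof. by rewrite val_mul => -> ->. Qed.

Lemma val_eqX f a n : v f = a%:E -> v (f ^+ n) = (a * n%:Z)%:E.
Proof.
move=> vf; elim: n => [|n IH]; first by rewrite mulr0 val1.
by rewrite exprS (val_eqM vf IH); congr _%:E; lia.
Qed.

Lemma le_valD f h (a : \bar int) :
  (a <= v f)%E -> (a <= v h)%E -> (a <= v (f + h)%R)%E.
Proof.
by move=> af ah; apply: le_trans (val_add v f h); rewrite le_min af ah.
Qed.

Lemma le_valM f h a b :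
  (a%:E <= v f)%E -> (b%:E <= v h)%E -> ((a + b)%:E <= v (f * h)%R)%E.
Proof. by move=> af bh; rewrite val_mul EFinD leeD. Qed.

Lemma le_valX f n : (0 <= v f)%E -> (0 <= v (f ^+ n)%R)%E.
Proof.
move=> f0; elim: n => [|n IH]; first by rewrite val1.
by rewrite exprS -[0%E]/((0 + 0)%:E); apply: le_valM.
Qed.

Lemma le_val_scale f h a : (0 <= v f)%E -> (a%:E <= v h)%E -> (a%:E <= v (f * h)%R)%E.
Proof. by move=> f0 ah; rewrite -(add0r a); apply: le_valM. Qed.

Lemma le_val_const (c : k) : (0 <= v (iota c))%E.
Proof.
have [->|c0] := eqVneq c 0; first by rewrite rmorph0 val0 leey.
by rewrite val_const.
Qed.

Lemma val_eq_jump f a :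
  (a%:E <= v f)%E -> ~ ((a + 1)%:E <= v f)%E -> v f = a%:E.
Proof.
have [->|f0] := eqVneq f 0; first by rewrite val0 !leey.
have [b ->] := val_fin f0; rewrite !lee_fin => ab nab.
by congr _%:E; lia.
Qed.

(** The strict case of the ultrametric inequality: the term of smallest valuation
dominates the sum. *)
Lemma val_eqD f h a : v f = a%:E -> ((a + 1)%:E <= v h)%E -> v (f + h) = a%:E.
Proof.
move=> vf vh; apply: val_eq_jump.
  apply: le_valD; first by rewrite vf.
  by apply: le_trans vh; rewrite lee_fin; lia.
move=> vfh; have : ((a + 1)%:E <= v (f + h - h)%R)%E.
  by apply: le_valD => //; rewrite valN.
by rewrite addrK vf lee_fin; lia.
Qed.

Lemma val_unit_prod (s : seq K) :
  (forall z, z \in s -> v z = 0%E) -> v (\prod_(z <- s) z) = 0%E.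
Proof.
elim: s => [|z s IH] vs; first by rewrite big_nil val1.
rewrite big_cons val_mul vs ?mem_head // IH ?add0e // => y ys.
by rewrite vs // inE ys orbT.
Qed.

(** In a relation c_0 + c_1 h + ... = 0 with coefficients in a trivially valued
field, the first nonzero term has strictly smaller valuation than all the
others.  Horner induction peels off the zero coefficients, dividing by [h]. *)
Lemma not_root_trivially_valued (L : fieldType) (j : {rmorphism L -> K}) h a
    (q : {poly L}) :
  (forall c, c != 0 -> v (j c) = 0%E) -> 0 < a -> v h = a%:E -> q != 0 ->
  ~~ root (map_poly j q) h.
Proof.
move=> j_triv a0 vh.
have h0 : h != 0 by apply/eqP => /(val_eq_pinfty v); rewrite vh.
have j_int c : (0 <= v (j c))%E.
  have [->|c0] := eqVneq c 0; first by rewrite rmorph0 val0 leey.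
  by rewrite j_triv.
have hornerE r c :
    (map_poly j (r * 'X + c%:P)).[h] = (map_poly j r).[h] * h + j c.
  by rewrite rmorphD rmorphM /= map_polyX map_polyC hornerMXaddC.
have poly_int r : (0 <= v (map_poly j r).[h])%E.
  elim/poly_ind: r => [|r c IH]; first by rewrite rmorph0 horner0 val0 leey.
  rewrite hornerE; apply: le_valD => //.
  by rewrite val_mul adde_ge0 // vh lee_fin ltW.
elim/poly_ind: q => [|q c IH]; first by rewrite eqxx.
rewrite /root hornerE.
have [->|c0 _] := eqVneq c 0.
  rewrite !rmorph0 !addr0 => qX; apply: mulf_neq0 => //.
  by apply: IH; apply: contraNneq qX => ->; rewrite mul0r.
apply/eqP => E.
have : v (j c + (map_poly j q).[h] * h) = 0%:E.
  apply: val_eqD; first exact: j_triv.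
  by apply: le_val_scale => //; rewrite vh lee_fin; lia.
by rewrite addrC E val0.
Qed.

End Valuation.

Section ResidueField.
Variables (k : closedFieldType) (K : fieldType) (iota : {rmorphism k -> K}).
Hypothesis ffK : is_function_field iota.

(** If some nonzero q has v (q(u)) <> 0, then q splits over k and one of its linear
factors must have positive valuation at [u].  Otherwise v is trivial on k(u),
over which a uniformizer would be algebraic. *)
Lemma residue_constant (v : curve_point iota) u :
  (0 <= v u)%E -> exists c : k, (1%:E <= v (u - iota c)%R)%E.
Proof.
move=> u_int.
have [[q q0 vq]|triv] :=
  pselect (exists2 q : {poly k}, q != 0 & v (eval_at iota u q) <> 0%E); last first.
  have {}triv q : q != 0 -> v (eval_at iota u q) = 0%E.
    by move=> q0; apply: contrapT => vq; apply: triv; exists q.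
  have [x _ [n [b gen_b]]] := ffK.
  have transc_u q : q != 0 -> eval_at iota u q != 0.
    by move=> /triv vq; apply/eqP => /(val_eq_pinfty v); rewrite vq.
  have [t vt] := val_surj v.
  have /integral_algebraic[F F0 Ft] :=
    integral_simple_ext_transcendental gen_b transc_u t.
  suff triv_val (c : simple_ext_field iota u) : c != 0 -> v (sext_val c) = 0%E.
    by have /negP := not_root_trivially_valued triv_val ltr01 vt F0.
  move=> c0.
  have /asboolP/in_simple_extP[N [D [D0 cE]]] := sext_valP c.
  have ND0 : sext_val c != 0 by rewrite fmorph_eq0.
  have N0 : N != 0 by apply: contraNneq ND0 => N0; rewrite cE N0 rmorph0 mul0r.
  have D'0 : D != 0 by apply: contraNneq D0 => ->; rewrite rmorph0.
  have := congr1 v (divfK D0 (eval_at iota u N)).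
  by rewrite -cE val_mul !triv // adde0.
have [s qE] := closed_field_poly_normal q.
have lead_q : lead_coef q != 0 by rewrite lead_coef_eq0.
have [c _ vc] : exists2 c, c \in s & v (u - iota c) <> 0%E.
  apply: contrapT => all0; apply: vq.
  have -> : eval_at iota u q =
      iota (lead_coef q) * \prod_(z <- [seq u - iota c | c <- s]) z.
    rewrite big_map {1}qE /eval_at /= map_polyZ /= /horner_eval hornerZ.
    rewrite rmorph_prod horner_prod; congr (_ * _); apply: eq_bigr => c _.
    by rewrite /= map_polyXsubC hornerXsubC.
  rewrite val_mul val_const // add0e val_unit_prod // => _ /mapP[c cs ->].
  by apply: contrapT => vc; apply: all0; exists c.
exists c; have uc_int : (0 <= v (u - iota c)%R)%E.
  by apply: le_valD => //; rewrite valN le_val_const.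
apply: contrapT => nvc; apply: vc; exact: val_eq_jump.
Qed.

End ResidueField.

(** * Displacement of functions by an automorphism *)

Section Displacement.
Variables (k : closedFieldType) (K : fieldType) (iota : {rmorphism k -> K}).
Hypothesis ffK : is_function_field iota.
Variables (v : curve_point iota) (s : aut iota) (t : K) (i : nat).
Hypothesis (v_fixed : forall f, v (s f) = v f) (vt : v t = 1%:E).

(** Subtracting a residue constant, which [s] fixes, leaves a multiple t w of the
uniformizer, and [s (t w) - t w = s w (s t - t) + (s w - w) t]; each step thus
gains one order of vanishing, until the bound for [s t - t] is met. *)
Lemma displacement_integral h :
  (i.+1%:Z%:E <= v (s t - t)%R)%E -> (0 <= v h)%E ->
  (i.+1%:Z%:E <= v (s h - h)%R)%E.
Proof.
move=> st h_int.
suff : forall j, (j <= i.+1)%N -> forall h, (0 <= v h)%E ->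
    (j%:Z%:E <= v (s h - h)%R)%E by apply.
elim=> [|j IH] ji {h_int}h h_int.
  by apply: le_valD; rewrite ?valN ?v_fixed.
have t0 : t != 0 by apply/eqP => /(val_eq_pinfty v); rewrite vt.
have [c uc] := residue_constant ffK h_int.
pose w := (h - iota c) / t.
have hE : h = iota c + t * w by rewrite /w; field.
have w_int : (0 <= v w)%E.
  have : v (w * t) = v (h - iota c) by rewrite /w divfK.
  rewrite val_mul vt; have [->|w0] := eqVneq w 0; first by rewrite val0 leey.
  have [a ->] := val_fin v w0; rewrite -EFinD => E.
  by move: uc; rewrite -E !lee_fin; lia.
have -> : s h - h = s w * (s t - t) + (s w - w) * t.
  by rewrite hE rmorphD rmorphM aut_fun_const; ring.
apply: le_valD.
  apply: le_val_scale; first by rewrite v_fixed.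
  by apply: le_trans st; rewrite lee_fin; lia.
have -> : (j.+1%:Z = j%:Z + 1)%R by lia.
by apply: le_valM; [apply: IH => //; exact: ltnW | rewrite vt].
Qed.

Lemma val_binomial_remainder e (n : nat) : (i%:Z%:E <= v e)%E ->
  ((i + i)%:Z%:E <= v ((1 + e) ^+ n - 1 - n%:R * e)%R)%E.
Proof.
move=> vi; have e_int : (0 <= v e)%E by apply: le_trans vi; rewrite lee_fin.
have nat_int m : (0 <= v m%:R)%E.
  by rewrite -(rmorph_nat iota); exact: le_val_const.
elim: n => [|n IH].
  by rewrite expr0 mul0r subr0 subrr val0 leey.
have -> : (1 + e) ^+ n.+1 - 1 - n.+1%:R * e =
    (1 + e) * ((1 + e) ^+ n - 1 - n%:R * e) + n%:R * (e * e).
  by rewrite exprS -natr1; ring.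
apply: le_valD.
  by apply: le_val_scale => //; apply: le_valD => //; rewrite val1.
by apply: le_val_scale => //; rewrite PoszD; exact: le_valM.
Qed.

(** With [w = f * t ^+ m] a unit and [s t = t * (1 + e)], one has
[(s f - f) * s t ^+ m = (s w - w) - w * ((1 + e) ^+ m - 1)], where the last
factor is m e up to order 2i > i.  Its valuation is exactly i because m is
invertible in k. *)
Lemma val_displacement_pole f (m : nat) :
  (0 < i)%N -> v (s t - t) = i.+1%:Z%:E -> m%:R != 0 :> k ->
  v f = (- m%:Z)%:E -> v (s f - f) = (i%:Z - m%:Z)%:E.
Proof.
move=> i0 st m0 vf.
have t0 : t != 0 by apply/eqP => /(val_eq_pinfty v); rewrite vt.
have st0 : s t != 0 by rewrite fmorph_eq0.
pose e := (s t - t) / t.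
have stE : s t = t * (1 + e) by rewrite /e; field.
have ve : v e = i%:Z%:E.
  have : v (e * t) = i.+1%:Z%:E by rewrite /e divfK.
  have [->|e0] := eqVneq e 0; first by rewrite mul0r val0.
  have [a va] := val_fin v e0; rewrite (val_eqM va vt) va => -[]/= E.
  by congr _%:E; lia.
pose w := f * t ^+ m.
have vw : v w = 0%:E.
  by rewrite (val_eqM vf (val_eqX m vt)); congr _%:E; lia.
have w_move : (i.+1%:Z%:E <= v (s w - w)%R)%E.
  by apply: displacement_integral; rewrite ?st ?vw.
have v_pow : v ((1 + e) ^+ m - 1) = i%:Z%:E.
  have -> : (1 + e) ^+ m - 1 = m%:R * e + ((1 + e) ^+ m - 1 - m%:R * e) by ring.
  apply: val_eqD.
    by rewrite val_mul -(rmorph_nat iota) val_const // add0e.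
  have := @val_binomial_remainder e m; rewrite ve => /(_ (lexx _)).
  by apply: le_trans; rewrite lee_fin; lia.
have moveE : (s f - f) * (s t) ^+ m = (s w - w) - w * ((1 + e) ^+ m - 1).
  by rewrite /w rmorphM rmorphXn stE exprMn; ring.
have : v ((s f - f) * s t ^+ m) = i%:Z%:E.
  rewrite moveE addrC; apply: val_eqD.
    by rewrite valN (val_eqM vw v_pow) add0r.
  by apply: le_trans w_move; rewrite lee_fin; lia.
have vst : v (s t) = 1%:E by rewrite v_fixed.
have [->|sf0] := eqVneq (s f - f) 0; first by rewrite mul0r val0.
have [a va] := val_fin v sf0; rewrite (val_eqM va (val_eqX m vst)) va => -[]/= E.
by congr _%:E; lia.
Qed.

End Displacement.

(** * Functions without poles *)

Section RegularFunctions.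
Variables (k : closedFieldType) (K : fieldType) (iota : {rmorphism k -> K}).

Lemma dependent_of_has_dim (V : set K) n (a : nat -> K) :
  has_dim iota V n -> (forall j, V (a j)) ->
  exists2 c : 'rV[k]_n.+1, c != 0 & \sum_(j < n.+1) iota (c 0 j) * a j = 0.
Proof.
move=> [b [_ bV]] aV.
have /choice[C CE] : forall j : 'I_n.+1, exists c : 'rV[k]_n,
  a j = \sum_(l < n) iota (c 0 l) * b l by move=> j; apply/bV.
pose M := \matrix_j C j.
have : kermx M != 0.
  by rewrite kermx_eq0 /row_free neq_ltn ltnS rank_leq_col.
move=> /rowV0Pn[c /sub_kermxP cM c0]; exists c => //.
under eq_bigr do rewrite CE mulr_sumr.
rewrite exchange_big big1 //= => l _.
have /rowP/(_ l) := cM; rewrite !mxE => cMl.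
under eq_bigr do rewrite mulrA -rmorphM.
rewrite -mulr_suml -rmorph_sum.
suff -> : \sum_(j < n.+1) c 0 j * C j 0 l = 0 by rewrite rmorph0 mul0r.
by rewrite -[RHS]cMl; apply: eq_bigr => j _; rewrite mxE.
Qed.

Variables (g : nat) (hg : is_genus iota g).

(** Let D attain the genus.  If L(D) and L(D + P) were equal, then D + P would have
larger degree and the same dimension, against maximality.  So some w lies in
L(D + P) but not in L(D); the zero of [h] at P absorbs the extra pole and puts
every [w * h * h ^+ j] in L(D).  A linear relation among these makes [h]
algebraic over k, which its positive valuation at P forbids. *)
Lemma regular_vanishing_eq0 (P : curve_point iota) h :
  (forall Q : curve_point iota, (0 <= Q h)%E) -> (1%:E <= P h)%E -> h = 0.
Proof.
move=> h_reg hP; apply: contrapT => /eqP h0.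
have [D_le [D [n [dimD D_max]]]] := hg.
have D'D Q : coeff Q (D + << P >>) = coeff Q D + (P == Q)%:R.
  by rewrite coeffD coeffU mul1r.
have subD : Lspace D `<=` Lspace (D + << P >>).
  move=> f fD Q; apply: le_trans (fD Q); rewrite D'D lee_fin.
  by case: (P == Q); rewrite ?addr0 // opprD; lia.
have [w wD' wnD] : exists2 w, Lspace (D + << P >>) w & ~ Lspace D w.
  apply: contrapT => DE.
  have : Lspace (D + << P >>) = Lspace D.
    apply/seteqP; split=> // w wD'; apply: contrapT => wD; apply: DE.
    by exists w.
  move=> D'E; have := D_le (D + << P >>) n; rewrite D'E => /(_ dimD).
  by rewrite degD degU; lia.
have w0 : w != 0.
  by apply/eqP => w0; apply: wnD => Q; rewrite w0 val0 leey.
have whD j : Lspace D (w * h * h ^+ j).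
  move=> Q; rewrite mulrC; apply: le_val_scale.
    exact: le_valX.
  have := wD' Q; rewrite D'D; have [<-|_] := eqVneq P Q => wQ.
    have -> : - coeff P D = - (coeff P D + 1) + 1 by ring.
    exact: le_valM.
  by rewrite mulrC; apply: le_val_scale => //; rewrite addr0 in wQ.
have [c c0 cE] := dependent_of_has_dim dimD whD.
pose q := \poly_(j < n.+1) c 0 (inord j).
have q0 : q != 0.
  apply: contraNneq c0 => q0; apply/eqP/rowP => j.
  have := congr1 (fun r : {poly k} => r`_j) q0.
  by rewrite coef_poly ltn_ord coef0 inord_val mxE.
have [a Pa] := val_fin P h0.
have a0 : 0 < a by move: hP; rewrite Pa lee_fin; lia.
have iota_triv c' : c' != 0 -> P (iota c') = 0%E by exact: val_const.
have /negP[] := not_root_trivially_valued iota_triv a0 Pa q0.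
apply/eqP; apply: (mulfI (mulf_neq0 w0 h0)); rewrite mulr0 -[RHS]cE.
rewrite (@horner_coef_wide _ n.+1); last first.
  by rewrite size_map_poly size_poly.
rewrite mulr_sumr; apply: eq_bigr => j _.
by rewrite coef_map coef_poly ltn_ord inord_val mulrCA.
Qed.

End RegularFunctions.

(** * Pole numbers and the stabilizer of a point *)

Section PoleFiltration.
Variables (k K : fieldType) (iota : {rmorphism k -> K}) (P : curve_point iota).

Lemma LspaceP (n : int) f : Lspace << n *g P >> f <->
  ((- n)%:E <= P f)%E /\ (forall Q : curve_point iota, Q <> P -> (0 <= Q f)%E).
Proof.
split=> [fL|[fP fQ] Q]; rewrite ?coeffU.
  split=> [|Q QP]; first by have := fL P; rewrite coeffU eqxx mulr1.
  by have := fL Q; rewrite coeffU eq_sym; move/eqP/negPf: QP => ->; rewrite mulr0.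
have [<-|/eqP PQ] := eqVneq P Q; first by rewrite mulr1.
by rewrite mulr0; apply: fQ => QP; exact: PQ.
Qed.

Lemma pole_numberP (n : nat) : (0 < n)%N -> pole_number P n <->
  exists2 f, P f = (- n%:Z)%:E &
    forall Q : curve_point iota, Q <> P -> (0 <= Q f)%E.
Proof.
move=> n0; split=> [[n_eq0|[_ nsub]]|[f fP fQ]].
- by rewrite n_eq0 in n0.
- have [f /LspaceP[fP fQ] nf] :
      exists2 f, Lspace << n%:Z *g P >> f & ~ Lspace << (n%:Z - 1) *g P >> f.
    apply: contrapT => all_in; apply: nsub => f fL; apply: contrapT => nf.
    by apply: all_in; exists f.
  exists f => //; apply: val_eq_jump => // fP'; apply: nf; apply/LspaceP.
  by split=> //; apply: le_trans fP'; rewrite lee_fin; lia.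
- right; split=> [h /LspaceP[hP hQ]|/(_ f)].
    apply/LspaceP; split=> //; apply: le_trans hP; rewrite lee_fin; lia.
  have fL : Lspace << n%:Z *g P >> f by apply/LspaceP; rewrite fP.
  by move=> /(_ fL)/LspaceP[]; rewrite fP lee_fin; lia.
Qed.

Variable s : aut iota.
Hypothesis sP : act_point s P = P.

Lemma val_stabilizer f : P (s f) = P f.
Proof. by rewrite -{1}sP /= aut_funK. Qed.

(** [s] permutes the points of the curve other than P. *)
Lemma regular_away_stabilizer f :
  (forall Q : curve_point iota, Q <> P -> (0 <= Q f)%E) ->
  forall Q : curve_point iota, Q <> P -> (0 <= Q (s f))%E.
Proof.
move=> f_reg Q QP; apply: (f_reg (act_point (aut_inv s) Q)) => sQ; apply: QP.
apply: curve_point_ext => h.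
by rewrite -[h in RHS](aut_invfunK s) val_stabilizer -sQ /= aut_invfunK.
Qed.

End PoleFiltration.

(** * Jumps of the ramification filtration *)

Theorem proposition2p2
  (k : closedFieldType) (p : nat) (hp : p \in [pchar k])
  (K : fieldType) (iota : {rmorphism k -> K}) (hK : is_function_field iota)
  (g : nat) (hg : is_genus iota g)
  (G : set (aut iota)) (hG : is_subgroup G) (finG : finite_set G)
  (P : curve_point iota) (hP : wildly_ramified p G P)
  (t : K) (ht : uniformizer P t)
  (m : nat) (m_pole : pole_number P m) (m_ndvd : ~~ (p %| m)%N)
  (m_min : forall j : nat, pole_number P j -> ~~ (p %| j)%N -> (m <= j)%N)
  (m_le : m%:Z <= 2 * g%:Z - 1)
  (r : nat) (ms : 'I_r.+1 -> nat)
  (ms_first : ms ord0 = m) (ms_last : ms ord_max = 0%N)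
  (ms_decr : forall a b : 'I_r.+1, (a < b)%N -> (ms b < ms a)%N)
  (ms_range : range ms = [set j : nat | pole_number P j /\ (j <= m)%N])
  (i : nat) (hi : (1 <= i)%N)
  (hjump : ramification_group G P t i.+1 `<` ramification_group G P t i) :
  exists a : 'I_r.+1, (i + 1 = m - ms a + 1)%N.
Proof.
have [_ n_jump] := hjump.
have [s [st_stab st_ge] st_lt] : exists2 s, ramification_group G P t i s &
    ~ ramification_group G P t i.+1 s.
  apply: contrapT => all_in; apply: n_jump => s si; apply: contrapT => nsi.
  by apply: all_in; exists s.
have [_ sP] := st_stab.
have st : P (s t - t) = i.+1%:Z%:E.
  apply: val_eq_jump => // st_gt; apply: st_lt; split.
    exact: st_stab.
  by apply: le_trans st_gt; rewrite lee_fin; lia.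
have m_gt0 : (0 < m)%N by case: (m) m_ndvd; rewrite ?dvdn0.
have m_neq0 : m%:R != 0 :> k by rewrite -(dvdn_pcharf hp).
have [f fP f_reg] := (pole_numberP P m_gt0).1 m_pole.
have v_move : P (s f - f) = (i%:Z - m%:Z)%:E.
  exact: (val_displacement_pole hK (val_stabilizer sP) ht hi st m_neq0 fP).
have move_reg (Q : curve_point iota) : Q <> P -> (0 <= Q (s f - f)%R)%E.
  move=> QP; apply: le_valD; last by rewrite valN; exact: f_reg.
  exact: (regular_away_stabilizer sP f_reg).
(* If m < i, then s f - f is regular everywhere and vanishes at P. *)
have i_le_m : (i <= m)%N.
  rewrite leqNgt; apply/negP => m_lt_i.
  have v_move_gt0 : (1%:E <= P (s f - f)%R)%E by rewrite v_move lee_fin; lia.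
  have move0 : s f - f = 0.
    apply: (regular_vanishing_eq0 hg _ v_move_gt0) => Q.
    have [->|/eqP] := eqVneq Q P; last exact: move_reg.
    by apply: le_trans v_move_gt0; rewrite lee_fin.
  by move: v_move; rewrite move0 val0.
have mi_pole : pole_number P (m - i).
  have [mi0|mi_gt0] := posnP (m - i); first by left.
  apply/(pole_numberP P mi_gt0); exists (s f - f) => //.
  by rewrite v_move; congr _%:E; lia.
have : range ms (m - i)%N by rewrite ms_range; split=> //; exact: leq_subr.
by case=> a _ aE; exists a; rewrite aE subKn.
Qed.
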